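(* Let $d\ge 1$ be an integer and fix a real number $\alpha\in[0,d]$. Define $$s_0(d,\alpha)=\sup\Bigl\{s\ge 0:\ \text{for every }\varepsilon>0\text{ there is }N_0\text{ such that } I^{(0)}_{s,d}(\delta;N)\le \delta^{d-\alpha}N^{s+\varepsilon}\text{ for all }N\ge N_0\text{ and all }\delta\in[N^{-d},1]\Bigr\}.$$ Then $$s_0(d,\alpha)\le \sigma_d(\alpha):=\frac{\alpha(2d-\alpha+1)-\{\alpha\}(1-\{\alpha\})}{2}.$$
   Context: For $\mathbf x=(x_1,\dots,x_d)\in\mathsf T_d=[0,1)^d$ (identified with $(\mathbb R/\mathbb Z)^d$) and an integer $N\ge1$, let $S_d(\mathbf x;N)=\sum_{n=1}^N \exp\bigl(2\pi i(x_1n+\dots+x_dn^d)\bigr)$. For real $s>0$ and $\delta\in(0,1]$, let $I^{(0)}_{s,d}(\delta;N)=\int_{[0,\delta]^d}|S_d(\mathbf x;N)|^{2s}\,d\mathbf x$. For real $x$, $\{x\}=x-\lfloor x\rfloor\in[0,1)$ denotes the fractional part. *)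

(* Defs.v *)
From HB Require Import structures.
From mathcomp Require Import all_boot all_order all_algebra complex.
From mathcomp Require Import all_classical all_reals all_analysis.

Set Implicit Arguments.
Unset Strict Implicit.
Unset Printing Implicit Defensive.
Import Order.TTheory GRing.Theory Num.Theory.
Import numFieldNormedType.Exports.
Local Open Scope classical_set_scope.
Local Open Scope ring_scope.

Section lebesgue_cons.
Context (R : realType) (n : nat).
Local Notation TR := (measurableTypeR R).
Variable m : {sigma_finite_measure set (n.-tuple TR) -> \bar R}.

Let tcons (p : TR * n.-tuple TR) : n.+1.-tuple TR := cons_tuple p.1 p.2.

Let measurable_tcons : measurable_fun setT tcons.
Proof. exact: (measurable_cons measurable_fst measurable_snd). Qed.

(* The product of the Lebesgue measure on R and of m, carried over from
   R * R^n to R^(n+1). *)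
Definition lebesgue_cons : set (n.+1.-tuple TR) -> \bar R :=
  pushforward (lebesgue_measure \x m)%E tcons.

Let lebesgue_cons0 : lebesgue_cons set0 = 0%E.
Proof. by rewrite /lebesgue_cons /pushforward preimage_set0 measure0. Qed.

Let lebesgue_cons_ge0 A : (0 <= lebesgue_cons A)%E.
Proof. exact: measure_ge0. Qed.

Let lebesgue_cons_sigma_additive : semi_sigma_additive lebesgue_cons.
Proof.
move=> F mF tF mUF; rewrite /lebesgue_cons /pushforward preimage_bigcup.
apply: measure_semi_sigma_additive.
- by move=> k; rewrite -[X in measurable X]setTI; exact: measurable_tcons.
- apply/trivIsetP => /= i j _ _ ij; rewrite -preimage_setI.
  by move/trivIsetP : tF => /(_ _ _ _ _ ij) ->//; rewrite preimage_set0.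
- rewrite -preimage_bigcup -[X in measurable X]setTI.
  exact: measurable_tcons.
Qed.

HB.instance Definition _ := isMeasure.Build _ _ _ lebesgue_cons
  lebesgue_cons0 lebesgue_cons_ge0 lebesgue_cons_sigma_additive.

Let lebesgue_cons_sigma_finite : sigma_finite setT lebesgue_cons.
Proof.
have /sigma_finiteP[F [TF ndF Foo]] := sigma_finiteT (@lebesgue_measure R).
have /sigma_finiteP[G [TG ndG Goo]] := sigma_finiteT m.
pose tuncons (t : n.+1.-tuple TR) : TR * n.-tuple TR :=
  (thead t, [tuple of behead t]).
have tconsK : tuncons \o tcons = id.
  by apply/funext => -[x t]; congr pair; exact/val_inj.
have muncons : measurable_fun setT tuncons.
  apply/measurable_fun_pair; last exact: measurable_behead.
  exact: measurable_tnth.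
exists (fun k => tuncons @^-1` (F k `*` G k)).
  rewrite -preimage_bigcup (_ : \bigcup_k _ = setT) ?preimage_setT//.
  apply/seteqP; split => // -[x t] _.
  have [i _ Fix] : (\bigcup_k F k) x by rewrite -TF.
  have [j _ Gjt] : (\bigcup_k G k) t by rewrite -TG.
  exists (maxn i j) => //; split.
  - by move: x Fix; exact/subsetPset/ndF/leq_maxl.
  - by move: t Gjt; exact/subsetPset/ndG/leq_maxr.
move=> k; have [mF Fk] := Foo k; have [mG Gk] := Goo k; split.
  by rewrite -[X in measurable X]setTI; apply: muncons => //; exact: measurableX.
rewrite /lebesgue_cons /pushforward -comp_preimage tconsK preimage_id.
by rewrite product_measure1E// lte_mul_pinfty// ge0_fin_numE.
Qed.

HB.instance Definition _ := Measure_isSigmaFinite.Build _ _ _ lebesgue_cons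
  lebesgue_cons_sigma_finite.

End lebesgue_cons.

Fixpoint lebesgue_tuple (R : realType) (n : nat) :
    {sigma_finite_measure set (n.-tuple (measurableTypeR R)) -> \bar R} :=
  match n with
  | 0 => \d_[tuple]
  | k.+1 => lebesgue_cons (lebesgue_tuple R k)
  end.

(* Characterizes lebesgue_tuple as the d-dimensional Lebesgue measure. *)
Lemma lebesgue_tuple_box (R : realType) (d : nat)
    (A : 'I_d -> set (measurableTypeR R)) :
  (forall i, measurable (A i)) ->
  lebesgue_tuple R d [set x | forall i, A i (tnth x i)] =
  (\prod_(i < d) lebesgue_measure (A i))%E.
Proof.
elim: d A => [|d IH] A mA.
  rewrite big_ord0 /= diracE mem_set//.
  by case.
rewrite big_ord_recl /= -IH; last by move=> i; exact: mA.
have mbox : measurable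
    [set t : d.-tuple (measurableTypeR R) | forall i, A (lift ord0 i) (tnth t i)].
  rewrite [X in measurable X](_ : _ =
    \bigcap_(i in [set: 'I_d]) ((@tnth d _)^~ i @^-1` A (lift ord0 i))).
    apply: fin_bigcap_measurable => // i _.
    by rewrite -[X in measurable X]setTI; exact: (measurable_tnth i).
  by apply/seteqP; split => [t At i _|t At i]; exact: At.
rewrite -product_measure1E// /lebesgue_cons /pushforward; congr (_ _).
apply/seteqP; split => [[x t] /= At|[x t] /= [Ax At] i].
  split; first exact: (At ord0).
  by move=> i; have := At (lift ord0 i); rewrite tnthS.
case: (unliftP ord0 i) => [j|] ->; last exact: Ax.
by rewrite tnthS; exact: At.
Qed.

(* Complex (cos theta) (sin theta) is exp(i theta); the coordinates x_1..x_d are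
   indexed from 0, whence the exponent j.+1. *)
Definition weyl_sum (R : realType) (d : nat) (x : d.-tuple R) (N : nat) : R[i] :=
  \sum_(1 <= n < N.+1)
    let theta := 2 * pi * \sum_(j < d) tnth x j * n%:R ^+ j.+1 in
    Complex (cos theta) (sin theta).

Definition cube (R : realType) (d : nat) (delta : R) : set (d.-tuple R) :=
  [set x | forall j, 0 <= tnth x j <= delta].

Definition mean_value0 (R : realType) (s : R) (d : nat) (delta : R) (N : nat) :
    \bar R :=
  (\int[lebesgue_tuple R d]_(x in cube delta)
     (Normc.normc (weyl_sum x N) `^ (2 * s))%:E)%E.

(* The supremum is taken in \bar R: the real-valued sup would be 0 on a set that
   is not bounded above. *)
Definition s0 (R : realType) (d : nat) (alpha : R) : \bar R :=
  ereal_sup [set s%:E | s in [set s : R | 0 <= s /\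
    forall eps : R, 0 < eps ->
    exists N0 : nat, forall N : nat, (1 <= N)%N -> (N0 <= N)%N ->
    forall delta : R, N%:R ^- d <= delta <= 1 ->
    (mean_value0 s d delta N <=
       (delta `^ (d%:R - alpha) * N%:R `^ (s + eps))%:E)%E]].

Definition fractional (R : realType) (x : R) : R := x - (Num.floor x)%:~R.

Definition sigma (R : realType) (d : nat) (alpha : R) : R :=
  (alpha * (2 * d%:R - alpha + 1)
   - fractional alpha * (1 - fractional alpha)) / 2.

(* Main.v *)
(* For an integer 0 <= k <= d take delta = N^-k. On the box
   0 <= x_j <= c / N^max(j,k), with c = 1/(8d), all the phases are at most pi/4,
   so |S_d(x;N)| >= N/2; the box lies in [0,delta]^d and has volume
   c^d N^-E with 2E = k^2 - k + d^2 + d. Comparing (N/2)^(2s) c^d N^-E with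
   N^(-k(d-alpha)) N^(s+eps) as N grows gives s <= E - k(d-alpha), and the choice
   k = d - floor(alpha) turns the right-hand side into sigma_d(alpha). *)
Require Import Defs.
From mathcomp Require Import all_boot all_order all_algebra.
From mathcomp Require Import all_classical all_reals all_analysis.
From mathcomp Require Import measurable_realfun complex ring lra zify.
Import Order.TTheory GRing.Theory Num.Theory.
Local Open Scope ring_scope.

(** Since 2x lies in [0, pi/2], 2 cos^2 x - 1 = cos 2x >= 0; with cos x >= 0 this gives cos x >=
    1/sqrt 2 > 1/2. *)
Lemma cos_ge_half (R : realType) (x : R) : 0 <= x <= pi / 4 -> 1 / 2 <= cos x.
Proof.
move=> /andP[x0 x4].
have p0 := pi_gt0 R.
have c0 : 0 <= cos x by apply: cos_ge0_pihalf; lra.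
have : 0 <= cos (x *+ 2) by apply: cos_ge0_pihalf; lra.
rewrite cos_mulr2n => c2; nra.
Qed.

Lemma weyl_sumE (R : realType) (d : nat) (x : d.-tuple R) (N : nat) :
  let theta n := 2 * pi * \sum_(j < d) tnth x j * n%:R ^+ j.+1 in
  weyl_sum x N = Complex (\sum_(1 <= n < N.+1) cos (theta n))
                         (\sum_(1 <= n < N.+1) sin (theta n)).
Proof.
move=> theta; rewrite /weyl_sum.
by elim/big_rec3 : _ => // n a b c _ ->.
Qed.

(** For n <= N each of the d terms of the phase is at most 2 pi / (8 d), so all phases lie in
    [0, pi/4] and the real part alone reaches N/2. *)
Lemma normc_weyl_sum_ge (R : realType) (d : nat) (x : d.-tuple R) (N : nat) :
  (forall j : 'I_d, 0 <= tnth x j <= (8 * d%:R)^-1 / N%:R ^+ j.+1) ->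
  N%:R / 2 <= Normc.normc (weyl_sum x N).
Proof.
move=> hx; rewrite weyl_sumE /=.
set C := (X in X ^+ 2 + _); set S := (X in _ + X ^+ 2).
have hC : N%:R / 2 <= C.
  have -> : N%:R / 2 = \sum_(1 <= n < N.+1) (1 / 2 : R).
    by rewrite sumr_const_nat subn1 /= -[RHS]mulr_natl mul1r.
  apply: ler_sum_nat => n /andP[n1 nN]; apply: cos_ge_half.
  have p0 := pi_gt0 R.
  have -> : pi / 4 = 2 * pi * 8%:R^-1 :> R by field.
  have n0 : 0 <= n%:R :> R by [].
  apply/andP; split.
    apply: mulr_ge0; first by rewrite mulr_ge0// ltW.
    by apply: sumr_ge0 => j _; apply: mulr_ge0; [case/andP: (hx j)|exact: exprn_ge0].
  rewrite ler_pM2l ?mulr_gt0//.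
  (* For d = 0 the inverse of 8 d is 0 and 1/8 cannot be split into d equal parts; the phase is then
     an empty sum. *)
  have [d0|d0] := posnP d.
    by subst d; rewrite big_ord0 invr_ge0.
  have -> : 8%:R^-1 = \sum_(j < d) (8 * d%:R)^-1 :> R.
    rewrite sumr_const card_ord -[RHS]mulr_natr; field.
    by rewrite pnatr_eq0 -lt0n.
  apply: ler_sum => j _; have /andP[xj0 xj] := hx j.
  have N0 : 0 < N%:R :> R by rewrite ltr0n; apply: leq_trans n1 _; rewrite -ltnS.
  apply: (@le_trans _ _ ((8 * d%:R)^-1 / N%:R ^+ j.+1 * N%:R ^+ j.+1)).
    apply: ler_pM => //.
    by apply: lerXn2r; rewrite ?nnegrE// ler_nat -ltnS.
  by rewrite divfK// expf_neq0// gt_eqF.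
apply: le_trans hC (le_trans (ler_norm C) _).
rewrite -sqrtr_sqr; apply: ler_wsqrtr.
by rewrite lerDl sqr_ge0.
Qed.

Lemma measurable_normc_weyl_sum (R : realType) (d N : nat) (p : R) :
  measurable_fun [set: d.-tuple (measurableTypeR R)]
    (fun x => (Normc.normc (weyl_sum x N) `^ p : R)).
Proof.
under eq_fun do rewrite weyl_sumE /=.
have mtheta (n : nat) : measurable_fun [set: d.-tuple (measurableTypeR R)]
    (fun x => 2 * pi * \sum_(j < d) tnth x j * n%:R ^+ j.+1 : R).
  apply: measurable_funM => //; apply: measurable_sum => j.
  by apply: measurable_funM => //; exact: measurable_tnth.
apply: (measurableT_comp (f := @powR R ^~ p)); first exact: measurable_powR.
(* [Num.sqrt] is 0 on negative numbers; truncating at 0 first makes the power function agree with it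
   there too. *)
have -> : @Num.sqrt R = (@powR R ^~ 2^-1) \o Num.max 0.
  apply/funext => y /=.
  have [y0|y0] := leP 0 y; first by rewrite powR12_sqrt.
  by rewrite powR0 ?invr_eq0// ler0_sqrtr// ltW.
apply: (measurableT_comp (f := @powR R ^~ 2^-1)); first exact: measurable_powR.
apply: measurable_maxr => //.
apply: measurable_funD; apply: measurable_funX; apply: measurable_sum => n.
  exact: measurableT_comp (continuous_measurable_fun (@continuous_cos R)) _.
exact: measurableT_comp (continuous_measurable_fun (@continuous_sin R)) _.
Qed.

Lemma measurable_box (R : realType) (d : nat)
    (A : 'I_d -> set (measurableTypeR R)) :
  (forall i, measurable (A i)) ->
  measurable [set x : d.-tuple (measurableTypeR R) | forall i, A i (tnth x i)].
Proof.
move=> mA; rewrite [X in measurable X](_ : _ =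
    \bigcap_(i in [set: 'I_d]) ((@tnth d _)^~ i @^-1` A i))%classic.
  apply: fin_bigcap_measurable => // i _.
  by rewrite -[X in measurable X]setTI; exact: (measurable_tnth i).
by apply/seteqP; split => [t At i _|t At i]; exact: At.
Qed.

(** The first k terms all equal k and the others are k+1, ..., d, whence the induction on d - k.
    Doubling and adding k avoids division and subtraction in [nat]. *)
Lemma sum_maxn (d k : nat) : (k <= d)%N ->
  ((\sum_(j < d) maxn j.+1 k).*2 + k = k ^ 2 + d ^ 2 + d)%N.
Proof.
move=> /subnKC <-; elim: (d - k)%N => [|m IH].
  rewrite addn0 (eq_bigr (fun=> k)) => [|j _]; last exact/maxn_idPr.
  by rewrite sum_nat_const card_ord; lia.
rewrite addnS big_ord_recr /= (maxn_idPl _).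
  by move: IH; set S := bigop.body _ _ _; rewrite -!mulnn; lia.
exact/leqW/leq_addr.
Qed.

(** The integrand is nonnegative, so the integral is at least (N/2)^(2s) times the volume of any box
    in the cube on which |S_d| >= N/2. *)
Lemma mean_value0_ge (R : realType) (s : R) (d k N : nat) :
  0 <= s -> (1 <= d)%N -> (1 <= N)%N ->
  (((N%:R / 2) `^ (2 * s) * (8 * d%:R)^-1 ^+ d
    / N%:R ^+ (\sum_(j < d) maxn j.+1 k))%:E
   <= mean_value0 s d (N%:R ^- k) N)%E.
Proof.
move=> s0 d0 N0.
have NR : 1 <= N%:R :> R by rewrite ler1n.
have NR0 : 0 < N%:R :> R by rewrite ltr0n.
set c : R := (8 * d%:R)^-1.
have c0 : 0 < c by rewrite invr_gt0 mulr_gt0// ltr0n.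
have c1 : c <= 1.
  by rewrite invf_le1 ?mulr_gt0 ?ltr0n// -natrM ler1n muln_gt0.
(* An exponent at least k keeps the box inside the cube, as c <= 1; an exponent at least j+1 keeps
   the phases small. *)
pose b (j : 'I_d) : R := c / N%:R ^+ maxn j.+1 k.
pose A (j : 'I_d) : set (measurableTypeR R) := `[0, b j]%classic.
have b0 j : 0 < b j by rewrite divr_gt0// exprn_gt0.
have bN (j : 'I_d) m : (m <= maxn j.+1 k)%N -> b j <= c / N%:R ^+ m.
  move=> mj; rewrite ler_pM2l// lef_pV2 ?posrE ?exprn_gt0//.
  exact: ler_weXn2l.
have mA j : measurable (A j) by exact: measurable_itv.
pose B : set (d.-tuple (measurableTypeR R)) :=
  [set x | forall j, A j (tnth x j)]%classic.
have mB : measurable B by exact: measurable_box.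
have mcube : measurable (cube (N%:R ^- k) : set (d.-tuple (measurableTypeR R))).
  rewrite [X in measurable X](_ : _ = [set x : d.-tuple (measurableTypeR R) |
    forall j, `[0, (N%:R ^- k : R)]%classic (tnth x j)]%classic).
    by apply: (@measurable_box R d (fun=> `[0, N%:R ^- k]%classic)) => j.
  by apply/seteqP; split=> x hx j; have := hx j; rewrite /= in_itv.
have BE : lebesgue_tuple R d B =
    (c ^+ d / N%:R ^+ (\sum_(j < d) maxn j.+1 k))%:E.
  rewrite lebesgue_tuple_box// (eq_bigr (fun j => (b j)%:E)) => [|j _].
    rewrite prodEFin; congr (_%:E).
    by rewrite big_split /= prodr_const card_ord prodfV prodrXr.
  by rewrite lebesgue_measure_itv /= lte_fin b0 -EFinB subr0.
have Bcube : (B `<=` @cube R d (N%:R ^- k))%classic.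
  move=> x Bx j; have := Bx j; rewrite /A /= in_itv /= => /andP[-> /le_trans]; apply.
  apply: le_trans (bN _ _ (leq_maxr _ _)) _.
  by rewrite ler_piMl// invr_ge0 exprn_ge0// ltW.
have mf D : measurable_fun D (fun x : d.-tuple (measurableTypeR R) =>
    ((Normc.normc (weyl_sum x N) `^ (2 * s))%:E : \bar R)).
  by apply/measurable_EFinP; apply: measurable_funTS; exact: measurable_normc_weyl_sum.
have f0 x : (0 <= (Normc.normc (@weyl_sum R d x N) `^ (2 * s))%:E)%E.
  by rewrite lee_fin powR_ge0.
rewrite /mean_value0.
apply: le_trans (ge0_subset_integral _ mB mcube (mf _) (fun x _ => f0 x) Bcube).
(* The lower bound becomes the integral over [B] of a constant, which leaves a pointwise comparison
   on [B]. *)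
rewrite -mulrA EFinM -BE -integral_cst//.
apply: ge0_le_integral => //= x Bx.
rewrite lee_fin; apply: ge0_ler_powR; rewrite ?nnegrE.
- by rewrite mulr_ge0.
- by rewrite divr_ge0.
- by case: (weyl_sum x N) => u v; exact: sqrtr_ge0.
apply: normc_weyl_sum_ge => j; have := Bx j.
rewrite /A /= in_itv /= => /andP[-> /le_trans]; apply.
exact/bN/leq_maxl.
Qed.

(** If t > 0, any integer N > C^(1/t) has N^t > C. *)
Lemma powR_bounded_le0 (R : realType) (t C : R) (N0 : nat) :
  (forall N : nat, (1 <= N)%N -> (N0 <= N)%N -> N%:R `^ t <= C) -> t <= 0.
Proof.
move=> bd; rewrite leNgt; apply/negP => t0.
have C0 : 0 <= C.
  by apply: le_trans (bd (maxn 1 N0) (leq_maxl _ _) (leq_maxr _ _)); exact: powR_ge0.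
pose M := maxn N0 (Num.truncn (C `^ t^-1)).+1.
have M1 : (1 <= M)%N by rewrite leq_max orbT.
have := bd M M1 (leq_maxl _ _).
have CE : C = (C `^ t^-1) `^ t by rewrite -powRrM mulVf ?powRr1// gt_eqF.
apply/negP; rewrite -ltNge [ltLHS]CE.
apply: gt0_ltr_powR => //; rewrite ?nnegrE ?powR_ge0//.
by apply: lt_le_trans (truncnS_gt _) _; rewrite ler_nat leq_maxr.
Qed.

Lemma exponent_le (R : realType) (s alpha : R) (d k : nat) :
  (1 <= d)%N -> (k <= d)%N -> 0 <= s ->
  (forall eps : R, 0 < eps ->
    exists N0 : nat, forall N : nat, (1 <= N)%N -> (N0 <= N)%N ->
    forall delta : R, N%:R ^- d <= delta <= 1 ->
    (mean_value0 s d delta N <=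
       (delta `^ (d%:R - alpha) * N%:R `^ (s + eps))%:E)%E) ->
  s <= (\sum_(j < d) maxn j.+1 k)%:R - k%:R * (d%:R - alpha).
Proof.
move=> d0 kd s0 bd; set E := (\sum_(j < d) _)%N.
(* The eps of the hypothesis becomes an arbitrary slack in the conclusion. *)
apply/ler_addgt0Pr => e e0; have [N0 {}bd] := bd e e0.
rewrite -subr_le0.
set c : R := (8 * d%:R)^-1.
have c0 : 0 < c by rewrite invr_gt0 mulr_gt0// ltr0n.
(* The bounding constant is the inverse of c^d / 2^(2s), the factor of the lower bound that is free
   of N. *)
apply: (@powR_bounded_le0 _ _ ((c ^+ d)^-1 * 2 `^ (2 * s)) N0) => N N1 NN0.
have NR : 1 <= N%:R :> R by rewrite ler1n.
have NR0 : 0 < N%:R :> R by rewrite ltr0n.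
have hdelta : N%:R ^- d <= (N%:R ^- k : R) <= 1.
  rewrite lef_pV2 ?posrE ?exprn_gt0// ler_weXn2l//=.
  by rewrite invf_le1 ?exprn_gt0// exprn_ege1.
have := le_trans (mean_value0_ge _ _ _ k _ s0 d0 N1) (bd N N1 NN0 _ hdelta).
rewrite lee_fin -/E -/c.
have -> : (N%:R / 2) `^ (2 * s) = N%:R `^ (2 * s) / 2 `^ (2 * s) :> R.
  by rewrite powRM// -powR_inv1// -powRrM mulN1r powRN.
have -> : (N%:R ^- k) `^ (d%:R - alpha) = N%:R `^ (- (k%:R * (d%:R - alpha))) :> R.
  by rewrite -powR_invn// -powRrM mulNr.
rewrite -(@powR_invn _ N%:R)//.
have powD (a b : R) : N%:R `^ (a + b) = N%:R `^ a * N%:R `^ b :> R.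
  by rewrite powRD// pnatr_eq0 -lt0n N1 implybT.
rewrite -powD => H.
(* The first two terms form the exponent of N in the lower bound; the last is minus its exponent in
   the upper bound, so that [H] applies. *)
have -> : s - (E%:R - k%:R * (d%:R - alpha) + e) =
  (2 * s) + (- E%:R) + (- (- (k%:R * (d%:R - alpha)) + (s + e))) by ring.
rewrite powD powRN powD ler_pdivrMr ?powR_gt0//.
apply: le_trans (ler_wpM2l _ H).
  rewrite le_eqVlt; apply/orP; left; apply/eqP; field.
  by rewrite ?gt_eqF ?powR_gt0 ?exprn_gt0.
by rewrite mulr_ge0 ?powR_ge0// invr_ge0 exprn_ge0// ltW.
Qed.

Theorem theorem2p3 (R : realType) (d : nat) (alpha : R) :
  (1 <= d)%N -> 0 <= alpha <= d%:R ->
  (s0 d alpha <= (sigma d alpha)%:E)%E.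
Proof.
move=> d1 /andP[a0 ad].
apply: ge_ereal_sup => _ [s [s_ge0 bd] <-]; rewrite lee_fin.
have [m flm] : exists m : nat, Num.floor alpha = m%:Z.
  by exists `|Num.floor alpha|%N; rewrite gez0_abs// floor_ge0.
have md : (m <= d)%N.
  by rewrite -(ler_nat R) (le_trans _ ad)// (le_trans _ (floor_le alpha))// flm.
(* Passing from k to k+1 changes the bound by k - (d - alpha), so it is least at the ceiling of d -
   alpha, which is d - m. *)
apply: le_trans (exponent_le _ _ _ _ _ d1 (leq_subr m d) s_ge0 bd) _.
have := sum_maxn _ _ (leq_subr m d).
set E := (\sum_(j < d) _)%N => /(congr1 (fun n : nat => n%:R : R)).
rewrite -addnn !natrD !natrX natrB// => HE.
(* With f = alpha - m, both sides equal d m + m (1 - m) / 2 + (d - m) f. *)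
rewrite /sigma /fractional flm -pmulrn; nra.
Qed.
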